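(* Let $(X,\mathcal B,m,T)$ be an invertible, conservative, ergodic, measure preserving transformation with $m(X)=\infty$. Then there is no sequence of constants $a_n>0$ $(n\ge 1)$ such that $$\frac{\Sigma_n(1_A)}{a_n}\ \xrightarrow[n\to\infty]{}\ m(A)\quad\text{a.e.}\qquad\text{for all } A\in\mathcal B \text{ with } 0<m(A)<\infty .$$
   Context: $(X,\mathcal B,m)$ is a (standard) $\sigma$-finite measure space; ''invertible'' means that $T$ is (modulo null sets) a bimeasurable bijection of $X$. $T$ is conservative if it has no wandering set of positive measure, and ergodic if every $T$-invariant measurable set is null or co-null. For an invertible $T$ and a measurable function $f$, the two-sided (symmetric) Birkhoff sums are $$\Sigma_n(f)(x):=\sum_{|k|<n}f(T^kx)\qquad(n\ge1).$$ *)

(* Defs.v *)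
From HB Require Import structures.
From mathcomp Require Import all_boot all_order all_algebra.
From mathcomp Require Import all_classical all_reals all_analysis.

Set Implicit Arguments.
Unset Strict Implicit.
Unset Printing Implicit Defensive.

Import Order.TTheory GRing.Theory Num.Theory.
Import numFieldNormedType.Exports.

Local Open Scope classical_set_scope.
Local Open Scope ring_scope.

Definition polish_metric (R : realType) (P : metricType R) : Prop :=
  (exists2 D : set P, countable D & dense D) /\
  (forall F : set_system P, ProperFilter F -> cauchy F ->
     exists p : P, F --> p).

(* The Polish space lives on a separate carrier P because X already has a
   measurable structure; f identifies X with P and measurable X with the Borel
   sets of P. *)
Definition standard_borel (R : realType) (d : measure_display)
    (X : measurableType d) : Prop :=
  exists (P : metricType R) (f : X -> P),
    [/\ polish_metric P,
        bijective f &
        forall A : set X, measurable A <-> <<s @open P >> (f @` A)].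

Section transformation.
Context (R : realType) (d : measure_display) (X : measurableType d).
Implicit Types (m : {measure set X -> \bar R}) (T Tinv : X -> X).

(* T restricts to a bimeasurable bijection of a co-null measurable set X0, with
   inverse Tinv there. Off X0, Tinv is arbitrary. *)
Definition invertible_mod_null m T Tinv : Prop :=
  exists X0 : set X,
    [/\ measurable X0, m (~` X0) = 0%E,
        measurable_fun X0 T /\ measurable_fun X0 Tinv,
        set_fun X0 X0 T /\ set_fun X0 X0 Tinv &
        {in X0, cancel T Tinv} /\ {in X0, cancel Tinv T}].

Definition measure_preserving m T : Prop :=
  measurable_fun [set: X] T /\
  forall A : set X, measurable A -> m (T @^-1` A) = m A.

Definition wandering T (W : set X) : Prop :=
  measurable W /\ trivIset [set: nat] (fun n => iter n T @^-1` W).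

Definition conservative m T : Prop :=
  ~ exists W : set X, wandering T W /\ (0 < m W)%E.

Definition ergodic m T : Prop :=
  forall A : set X, measurable A -> T @^-1` A = A ->
    m A = 0%E \/ m (~` A) = 0%E.

Definition iterz T Tinv (k : int) (x : X) : X :=
  match k with
  | Posz n => iter n T x
  | Negz n => iter n.+1 Tinv x
  end.

(* The index set is finite, so this is a genuine finite sum over k in int. *)
Definition symmetric_birkhoff_sum T Tinv (f : X -> R) (n : nat) (x : X) : R :=
  \sum_(k \in [set k : int | (`|k| < n)%N]) f (iterz T Tinv k x).

End transformation.

(* Main.v *)
Require Import Defs.
From HB Require Import structures.
From mathcomp Require Import all_boot all_order all_algebra.
From mathcomp Require Import all_classical all_reals all_analysis.
From mathcomp Require Import measurable_realfun zify ring lra.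

Import Order.TTheory GRing.Theory Num.Theory.
Import numFieldNormedType.Exports.

Local Open Scope classical_set_scope.
Local Open Scope ring_scope.

(** Suppose that the constants a_n exist.  Fix A with 0 < m(A) < oo, put
    c_n = a_n m(A), and let B be a subset of A, of almost full measure in A, on
    which the convergence for A is uniform (Egorov).  Along the orbit of a point
    of B, the visits to A and to B are two sets of integers alpha and beta, with
    beta inside alpha, and every window of radius n >= N centred at a point of
    beta contains c_n points of alpha up to a factor close to 1.  All the
    geometry of the proof is about these two sets of integers.

    Covering a window of radius n by blocks of length g, each of which is
    contained in a window of radius g around a point of beta, gives
    g c_n <= 4 n c_g (growth).  Applying the law to sets of arbitrarily large
    finite measure gives c_n = o(n); this is where m(X) = oo enters.

    Fix a small e > 0 and look at the forward counts #(alpha in [0, n)).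

    If they are at least e c_n, uniformly for n >= k0, on a subset G of B of
    positive measure, consider the gaps between visits to G.  Since
    c_n = o(n), the long gaps fill more than half of [0, n).  The first half of
    a gap of length l contains at least e c_(l/2) visits to A, which by growth
    is at least a multiple of l c_n / n; adding up, a fixed proportion of the
    c_n visits to A in [0, n) is to the set of points of A that do not see G
    during the next L steps.  By recurrence the measure of that set tends to 0
    as L grows, so the law for its complement in A is contradicted
    (balanced_orbit_absurd, forward_count_not_bounded_below).

    Otherwise almost every point of B has arbitrarily large n for which
    #(alpha in [0, n)) < e c_n.  Seen from such a point, the orbit lies on the
    left at all scales between n/4 and n.  Re-centring at a point of beta at
    distance about u = n/4 shows that c_(2u) is close to c_u
    (doubling_ratio_le): the c_u points near the origin form a cluster with
    almost nothing around it up to distance 2u.  Let z be a median point of this cluster and R the radius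
    at which the window around z first contains 1.2 c_u points.  The new points
    lie at distance at least 2u from z, and one of them, z', is in beta.  The
    window of radius R around z' then contains the c_u points around z' and,
    reaching up to z, also the half cluster on its side of z, hence about
    1.4 c_u points, although it should have about 1.2 c_u
    (one_sided_orbit_absurd, forward_count_not_small). *)

(** * Counting the points of a set of integers in a window *)

Definition visits (P : int -> bool) (p : int) (n : nat) : nat :=
  (\sum_(i < n) P (p + i%:Z)%R)%N.

(** The window is the open interval (k - n, k + n), which matches the index set
    |i| < n of the symmetric Birkhoff sums. *)
Definition centred (P : int -> bool) (k : int) (n : nat) : nat :=
  visits P (k - n%:Z + 1) (n + n).-1.

Lemma visits0 P p : visits P p 0 = 0%N.
Proof. by rewrite /visits big_ord0. Qed.

Lemma visitsS P p n : visits P p n.+1 = (visits P p n + P (p + n%:Z)%R)%N.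
Proof. by rewrite /visits big_ord_recr. Qed.

Lemma visits_cat P p m n :
  visits P p (m + n) = (visits P p m + visits P (p + m%:Z) n)%N.
Proof.
elim: n => [|n IH]; first by rewrite visits0 !addn0.
by rewrite addnS !visitsS IH addnA; congr (_ + P _)%N; lia.
Qed.

Lemma visits_split P p m n q : (m <= n)%N -> q = p + m%:Z ->
  visits P p n = (visits P p m + visits P q (n - m))%N.
Proof. by move=> mn ->; rewrite -visits_cat subnKC. Qed.

Lemma visits_sub P p n q m : p <= q -> q + m%:Z <= p + n%:Z ->
  (visits P q m <= visits P p n)%N.
Proof.
move=> pq qp.
rewrite (@visits_split P p `|q - p|%N n q); [|lia..].
rewrite (@visits_split P q m (n - `|q - p|)%N (q + m%:Z)); [|lia..].
lia.
Qed.

Lemma visits_sub2 P p n q m q' m' : p <= q -> q + m%:Z <= q' ->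
  q' + m'%:Z <= p + n%:Z ->
  (visits P q m + visits P q' m' <= visits P p n)%N.
Proof.
move=> pq qq' qp.
rewrite (@visits_split P p `|q' - p|%N n q'); [|lia..].
apply: leq_add; apply: visits_sub; lia.
Qed.

Lemma visits_size P p n : (visits P p n <= n)%N.
Proof.
by elim: n => [|n IH]; [rewrite visits0|rewrite visitsS; case: (P _); lia].
Qed.

Lemma visits_le (P Q : int -> bool) p n :
  (forall k, P k -> Q k) -> (visits P p n <= visits Q p n)%N.
Proof.
move=> PQ; apply: leq_sum => i _.
by case: (boolP (P _)) => // /PQ ->.
Qed.

Lemma visits_le_in (P Q : int -> bool) p n :
  (forall k, p <= k < p + n%:Z -> P k -> Q k) -> (visits P p n <= visits Q p n)%N.
Proof.
move=> PQ; apply: leq_sum => i _.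
case: (boolP (P _)) => // Pi; rewrite PQ //; have := ltn_ord i; lia.
Qed.

Lemma visits_none P p n :
  (forall k, p <= k < p + n%:Z -> ~~ P k) -> visits P p n = 0%N.
Proof.
move=> nP; rewrite /visits big1 // => i _.
by apply/eqP; rewrite eqb0 nP //; have := ltn_ord i; lia.
Qed.

Lemma visits_diff (P Q : int -> bool) p n : (forall k, Q k -> P k) ->
  (visits P p n = visits Q p n + visits (fun k => P k && ~~ Q k) p n)%N.
Proof.
move=> QP; rewrite /visits -big_split; apply: eq_bigr => i _ /=.
by have := QP (p + i%:Z); case: (Q _); case: (P _) => // /(_ isT).
Qed.


(** * Growth of the normalising constants *)

(** A block of length [g] containing a point of [be] lies in the window of radius
    [g] centred at that point. *)
Lemma visits_block (R : realType) (al be : int -> bool) (g : nat) (C : R) :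
  (forall k, be k -> al k) -> 0 <= C ->
  (forall k, be k -> (centred al k g)%:R <= C) ->
  forall p j, (visits be p (j * g))%:R <= j%:R * C.
Proof.
move=> ba C0 Hc p; elim=> [|j IH]; first by rewrite visits0 mul0r.
rewrite mulSn addnC visits_cat natrD -addn1 natrD mulrDl mul1r lerD //.
set q := (p + _).
have [[k /andP[bk kr]]|nk] := pselect (exists k, be k && (q <= k < q + g%:Z)).
  apply: le_trans (Hc _ bk); rewrite ler_nat.
  apply: (leq_trans (visits_le _ _ _ _ ba)).
  by apply: visits_sub; lia.
rewrite visits_none // => k kr; apply/negP => bk; apply: nk; exists k.
by rewrite bk.
Qed.

(** The window of radius [n] is covered by about [2n/g] blocks of length [g], each
    with at most about [c g] points of [be]. *)
Lemma growth (R : realType) (al be : int -> bool) (c : nat -> R) (n g : nat) :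
  (forall k, be k -> al k) -> 0 <= c g ->
  (forall k, be k -> (centred al k g)%:R <= 1001 / 1000 * c g) ->
  (0 < g <= n)%N -> 9 / 10 * c n <= (centred be 0 n)%:R ->
  g%:R * c n <= 4 * n%:R * c g.
Proof.
move=> ba c0 Hc /andP[g0 gn] Hn.
pose j := ((n + n) %/ g).+1.
have jg : ((n + n).-1 <= j * g)%N.
  rewrite /j; have := divn_eq (n + n) g; have := ltn_pmod (n + n) g0; nia.
have jg3 : (j * g <= 3 * n)%N.
  rewrite /j; have := leq_trunc_div (n + n) g; nia.
have cn : 9 / 10 * c n <= j%:R * (1001 / 1000 * c g).
  apply: (le_trans Hn).
  have C0 : 0 <= 1001 / 1000 * c g by nra.
  apply: le_trans (@visits_block R al be g _ ba C0 Hc (0 - n%:Z + 1) j).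
  by rewrite ler_nat; apply: visits_sub; lia.
have jg3' : (j%:R * g%:R <= 3 * n%:R :> R) by rewrite -!natrM ler_nat.
have g0' : (0 : R) <= g%:R by [].
have cn' := ler_wpM2l g0' cn.
have cg := ler_wpM2r c0 jg3'.
have ncg : 0 <= n%:R * c g by rewrite mulr_ge0.
lra.
Qed.

(** * Orbits with forward counts bounded below *)

Lemma least_offset (P : int -> bool) (y : int) (m n : nat) :
  (exists i, (m <= i < n)%N && P (y + i%:Z)) ->
  exists i, [/\ (m <= i < n)%N, P (y + i%:Z) &
    forall j, (m <= j < i)%N -> ~~ P (y + j%:Z)].
Proof.
move=> ex; have := ex_minnP ex => -[i /andP[i1 Pi] imin].
exists i; split=> // j jr; apply/negP => Pj.
have := imin j; rewrite Pj; lia.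
Qed.

(** Here [al], [be], [ga], [de] are the times of visits to A, to the set B of
    uniform convergence, to the set G where the forward counts are at least
    [e * c r], and to the points of A that meet G within the next [L] steps.  The
    first half of a gap of [ga] of length at least [2L] avoids [de] but contains
    a proportional share of [al].  As [ga] has few points compared with [n], long
    gaps cover most of [0, n), which forces many points of [al] outside [de]. *)
Lemma balanced_orbit_absurd (R : realType) (al be ga de : int -> bool)
    (c : nat -> R) (e : R) (n0 L n : nat) :
  (forall k, be k -> al k) -> (forall k, ga k -> be k) ->
  (forall k, de k -> al k) -> (forall n, 0 <= c n) -> 0 < c n -> 0 < e ->
  (forall k, be k -> forall r, (n0 <= r)%N ->
    (centred al k r)%:R <= 1001 / 1000 * c r) ->
  (forall k, ga k -> forall r, (n0 <= r)%N -> e * c r <= (visits al k r)%:R) ->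
  (forall k, de k -> exists2 i, (0 < i <= L)%N & ga (k + i%:Z)) ->
  ga 0 -> (n0 <= n)%N ->
  9 / 10 * c n <= (centred be 0 n)%:R ->
  (centred al 0 n)%:R - (centred de 0 n)%:R < e * c n / 64 ->
  4 * (n0 + L + 1)%:R * c n <= n%:R ->
  False.
Proof.
move=> ba gb da c0 cn0 e0 Hc Hg Hd g0 n0n Hb Hde Hn.
pose L0 := ((n0 + L + 1) * 2)%N.
pose tau k := al k && ~~ de k.
have npos : (0 < n)%N.
  rewrite -(ltr_nat R); apply: lt_le_trans Hn.
  by rewrite mulr_gt0// mulr_gt0// ltr0n addn1.
have nR : (0 : R) < n%:R by rewrite ltr0n.
(* K is the density of points of tau that growth guarantees in a long gap. *)
pose K := e * c n / (16 * n%:R).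
have K0 : 0 < K by rewrite /K divr_gt0 ?mulr_gt0.
have gap y l : ga y -> (forall k, y < k < y + l%:Z -> ~~ ga k) ->
    (L0 <= l <= n)%N -> K * l%:R <= (visits tau y l)%:R.
  move=> gy nogap lr.
  have [h [hn0 hL hl h0]] :
      exists h, [/\ (n0 <= h)%N, (h + L <= l)%N, (l <= 4 * h)%N & (0 < h <= n)%N].
    by clear -lr; exists l./2; split; lia.
  have : (visits al y h <= visits tau y l)%N.
    apply: (@leq_trans (visits tau y h)); last first.
      by apply: visits_sub; clear -hL; lia.
    apply: visits_le_in => k kr ak; rewrite /tau ak /=.
    apply/negP => /Hd[i ir]; apply/negP; apply: nogap; clear -kr ir hL; lia.
  rewrite -(ler_nat R); apply: le_trans.
  apply: le_trans (Hg _ gy _ hn0).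
  have h1 : h%:R * c n <= 4 * n%:R * c h.
    by apply: (@growth R al be) => // k bk; exact: Hc.
  have h2 : (l%:R <= 4 * h%:R :> R) by rewrite -natrM ler_nat.
  rewrite /K mulrAC ler_pdivrMr ?mulr_gt0//.
  have h3 : l%:R * c n <= 16 * n%:R * c h.
    have := ler_wpM2r (c0 n) h2; clear -h1; lra.
  have := ler_wpM2l (ltW e0) h3; clear; lra.
(* Induction along the successive points of ga: each point of ga costs at most
   one short gap of length L0, and a long gap pays for its own length. *)
have main : forall l y, (l <= n)%N -> ga y ->
    K * (l%:R - L0%:R * (visits ga y l)%:R) <= (visits tau y l)%:R.
  elim/ltn_ind => l IH y ln gy.
  have [->|l0] := posnP l; first by rewrite !visits0 mulr0 subr0 mulr0.
  have g1 i : (0 < i)%N -> (1 <= visits ga y i)%N.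
    move=> i0; rewrite (@visits_split ga y 1%N i (y + 1)) // visitsS visits0.
    by rewrite addr0 gy.
  have neg i : (0 < i <= L0)%N -> K * (i%:R - L0%:R * (visits ga y i)%:R) <= 0.
    move=> /andP[i0 iL]; rewrite pmulr_rle0// subr_le0 -natrM ler_nat.
    rewrite (leq_trans iL)// -[leqLHS]muln1 leq_mul2l g1 ?orbT//.
  have [lL|lL] := leqP l L0.
    by apply: (le_trans (neg _ _)); rewrite ?l0 ?lL.
  have pos i : (L0 <= i <= n)%N -> (forall k, y < k < y + i%:Z -> ~~ ga k) ->
      K * (i%:R - L0%:R * (visits ga y i)%:R) <= (visits tau y i)%:R.
    move=> ir nog; apply: le_trans (gap y i gy nog ir).
    by rewrite ler_pM2l// lerBlDr lerDl mulr_ge0.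
  have [ex|nex] := pselect (exists i, (1 <= i < l)%N && ga (y + i%:Z)).
    have [i [ir gi imin]] := @least_offset _ _ _ _ ex.
    have [i0 il] := andP ir.
    have lin : (l - i < l)%N by clear -i0 il; lia.
    rewrite (@visits_split ga y i l (y + i%:Z)) //; last exact: ltnW.
    rewrite (@visits_split tau y i l (y + i%:Z)) //; last exact: ltnW.
    have -> : (l%:R = i%:R + (l - i)%:R :> R) by rewrite -natrD subnKC// ltnW.
    rewrite !natrD; set x := (visits ga y i)%:R; set x' := (visits ga _ _)%:R.
    rewrite (_ : _ * _ = K * (i%:R - L0%:R * x)
       + K * ((l - i)%:R - L0%:R * x')); last by ring.
    apply: lerD; last first.
      by apply: IH => //; rewrite (leq_trans (ltnW lin)).
    have [iL|iL] := leqP i L0.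
      by apply: (le_trans (neg _ _)); rewrite ?i0 ?iL.
    apply: pos => [|k kr].
      by rewrite (ltnW iL) (leq_trans (ltnW il)).
    have -> : k = y + `|k - y|%N%:Z by clear -kr; lia.
    by apply: imin; clear -kr; lia.
  apply: pos => [|k kr]; first by rewrite (ltnW lL).
  apply/negP => gk; apply: nex; exists `|k - y|%N; apply/andP; split.
    by clear -kr; lia.
  by have -> : y + `|k - y|%N%:Z = k by clear -kr; lia.
have {main}m := main n 0 (leqnn n) g0.
have gcnt : (visits ga 0 n)%:R <= 1001 / 1000 * c n.
  apply: le_trans (Hc 0 (gb _ g0) n n0n); rewrite ler_nat.
  apply: (@leq_trans (visits al 0 n)).
    by apply: visits_le => k /gb /ba.
  by apply: visits_sub; clear -npos; lia.
have tcnt : (visits tau 0 n)%:R < e * c n / 64.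
  apply: le_lt_trans Hde; rewrite lerBrDr -natrD ler_nat.
  rewrite /centred (@visits_diff al de) // addnC leq_add2l.
  by apply: visits_sub; clear -npos; lia.
have L0R : L0%:R = 2 * (n0 + L + 1)%:R :> R by rewrite /L0 natrM mulrC.
have gL : (L0%:R * (visits ga 0 n)%:R <= 3 / 4 * n%:R :> R).
  have arith (q v N C : R) : 0 < N -> 4 * q * C <= N ->
    2 * q * v <= 2 * q * (1001 / 1000 * C) -> 2 * q * v <= 3 / 4 * N by lra.
  rewrite L0R; apply: (arith _ _ _ _ nR Hn).
  by rewrite ler_wpM2l ?mulr_ge0.
have : e * c n / 64 <= K * (n%:R - L0%:R * (visits ga 0 n)%:R).
  apply: (@le_trans _ _ (K * (n%:R / 4))); last first.
    rewrite ler_pM2l//; move: gL; set z := L0%:R * _ => gL; clear -gL; lra.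
  rewrite /K (_ : e * c n / _ * _ = e * c n / 64) //.
  by field; rewrite lt0r_neq0.
clear -tcnt m; lra.
Qed.

Lemma centred0_split P n :
  (0 < n)%N ->
  centred P 0 n = (visits P (0 - n%:Z + 1) n.-1 + visits P 0 n)%N.
Proof.
move=> n0; rewrite /centred (@visits_split P _ n.-1 (n + n).-1 0); [|lia..].
by congr (_ + visits _ _ _)%N; lia.
Qed.

Lemma centred_le P k m n : (m <= n)%N -> (centred P k m <= centred P k n)%N.
Proof.
by case: m => [|m] mn; [rewrite /centred visits0|apply: visits_sub; lia].
Qed.

Lemma centredS_le P k n : (centred P k n.+1 <= centred P k n + 2)%N.
Proof.
case: n => [|n]; first by rewrite addn2 (leq_trans (visits_size _ _ _)).
rewrite /centred (@visits_split P _ 1%N _ (k - n.+1%:Z + 1)); [|lia..].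
have -> : ((n.+2 + n.+2).-1 - 1 = (n.+1 + n.+1).-1 + 1)%N by lia.
rewrite visits_cat.
rewrite addnCA leq_add2l.
by rewrite (leq_add (visits_size _ _ _) (visits_size _ _ _)).
Qed.

(** * Orbits with an almost empty forward half *)

(** If [- s] is the point of [be] nearest to the origin among those at distance
    at least [u], then [c s] is close to [c u] because [be] has no point in
    between, and the window of radius [s] around [- s] covers the left half of
    the window of radius [2u] around 0; the right half is negligible.  If there
    is no such point up to distance [2u], the windows of radius [u] and [2u]
    around 0 contain nearly the same points of [be]. *)
Lemma doubling_ratio_le (R : realType) (al be : int -> bool) (c : nat -> R)
    (n0 u : nat) :
  (forall k, be k -> al k) ->
  (forall k, be k -> forall r, (n0 <= r)%N ->
    999 / 1000 * c r <= (centred al k r)%:R <= 1001 / 1000 * c r) ->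
  be 0 ->
  (forall r, (u <= r)%N -> 998 / 1000 * c r <= (centred be 0 r)%:R) ->
  (n0 <= u)%N -> (0 < u)%N ->
  (visits al 0 (2 * u))%:R <= c u / 1000 ->
  c (2 * u)%N <= 1011 / 1000 * c u.
Proof.
move=> ba Hc b0 Hb n0u u0 Hr.
have cu0 : 0 <= c u.
  have /andP[] := Hc 0 b0 _ n0u.
  have : (0 : R) <= (centred al 0 u)%:R by [].
  by clear; lra.
have bu : (visits be (0 - u%:Z + 1) u.-1)%:R <= 1001 / 1000 * c u.
  have /andP[_] := Hc 0 b0 u n0u; apply: le_trans.
  rewrite ler_nat (leq_trans (visits_le _ _ _ _ ba))//.
  by apply: visits_sub; clear -u0; lia.
have right s : (u <= s <= 2 * u)%N -> (visits be 0 s)%:R <= c u / 1000.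
  move=> su; apply: le_trans Hr; rewrite ler_nat.
  by rewrite (leq_trans (visits_le _ _ _ _ ba))//; apply: visits_sub; clear -su; lia.
have cs s : (u <= s <= 2 * u)%N ->
    (forall i, (u <= i < s)%N -> ~~ be (- i%:Z)) ->
    998 / 1000 * c s <= 1002 / 1000 * c u.
  move=> su nobe; apply: (le_trans (Hb _ _)); first by case/andP: su.
  rewrite centred0_split; last by clear -su u0; lia.
  rewrite (@visits_split be _ (s - u)%N _ (0 - u%:Z + 1)); last 2 first.
    by clear -su u0; lia.
    by clear -su u0; lia.
  rewrite visits_none ?add0n => [|k kr]; last first.
    have -> : k = - `|k|%N%:Z by clear -kr su; lia.
    by apply: nobe; clear -kr su; lia.
  rewrite (_ : (s.-1 - (s - u) = u.-1)%N); last by clear -su u0; lia.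
  by have := right _ su; rewrite natrD; clear -bu; lra.
have n02 : (n0 <= 2 * u)%N by clear -n0u; lia.
have [ex|nex] := pselect (exists i, (u <= i < 2 * u)%N && be (- i%:Z)); last first.
  have h := cs (2 * u)%N.
  have /h {h} : (u <= 2 * u <= 2 * u)%N by clear; lia.
  have bc : 0 <= c (2 * u)%N.
    have /andP[] := Hc 0 b0 _ n02.
    have : (0 : R) <= (centred al 0 (2 * u))%:R by [].
    clear; lra.
  move=> h; suff /h : forall i, (u <= i < 2 * u)%N -> ~~ be (- i%:Z).
    by clear -bc cu0; lra.
  by move=> i ir; apply/negP => bi; apply: nex; exists i; rewrite ir.
have [s /andP[sr bs] smin] := ex_minnP ex.
have su : (u <= s <= 2 * u)%N by clear -sr; lia.
have {}cs : 998 / 1000 * c s <= 1002 / 1000 * c u.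
  apply: cs => // i ir; apply/negP => bi.
  by have := smin i; rewrite bi; clear -ir sr; lia.
have n0s : (n0 <= s)%N by clear -su n0u; lia.
have /andP[_ hs] := Hc _ bs s n0s.
have /andP[h2 _] := Hc _ b0 _ n02.
have : (centred al 0 (2 * u) <= centred al (- s%:Z) s + visits al 0 (2 * u))%N.
  rewrite centred0_split; last by clear -u0; lia.
  by rewrite leq_add2r; apply: visits_sub; clear -su u0; lia.
rewrite -(ler_nat R) natrD.
by clear -hs h2 cs Hr cu0; lra.
Qed.

(** By [doubling_ratio_le] the points near the origin form an isolated cluster of
    about [c u] points.  A window around a median point [z] of the cluster that
    has grown to [1.2 * c u] points has reached a point [k] of [be] outside the
    cluster; the window of the same radius around [k] contains [c u] points near
    [k] and half of the cluster, which is too much. *)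
Lemma one_sided_orbit_absurd (R : realType) (al be : int -> bool) (c : nat -> R)
    (n0 u n : nat) :
  (forall k, be k -> al k) -> (forall r, 0 <= c r) ->
  (forall k, be k -> forall r, (n0 <= r)%N ->
    999 / 1000 * c r <= (centred al k r)%:R <= 1001 / 1000 * c r) ->
  be 0 ->
  (forall r, (u <= r)%N -> 998 / 1000 * c r <= (centred be 0 r)%:R) ->
  (forall K, exists2 r, (n0 <= r)%N & K <= c r) ->
  (n0 <= u)%N -> (0 < u)%N -> (4 * u <= n <= 5 * u)%N -> 1000 <= c u ->
  (visits al 0 n)%:R < c n / 20 / 1000 -> False.
Proof.
move=> ba c0 Hc b0 Hb Hinf n0u u0 nu cu Hn.
have HcU k (bk : be k) r (rn : (n0 <= r)%N) := proj2 (andP (Hc k bk r rn)).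
have HcL k (bk : be k) r (rn : (n0 <= r)%N) := proj1 (andP (Hc k bk r rn)).
have uR : (0 : R) < u%:R by rewrite ltr0n.
have right r : (r <= n)%N -> (visits al 0 r)%:R <= c u / 1000.
  move=> rn; apply: (@le_trans _ _ (visits al 0 n)%:R).
    by rewrite ler_nat; apply: visits_sub; clear -rn; lia.
  suff : c n <= 20 * c u by clear -Hn; lra.
  have n5 : (n%:R <= 5 * u%:R :> R).
    by rewrite -natrM ler_nat; clear -nu; lia.
  have h : u%:R * c n <= 4 * n%:R * c u.
    apply: (@growth R al be) => //.
    - by move=> k bk; apply: HcU.
    - by clear -nu u0; lia.
    - apply: le_trans (Hb n _); last by clear -nu; lia.
      by have := c0 n; clear; lra.
  rewrite -(ler_pM2l uR); apply: (le_trans h).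
  by have := ler_wpM2r (c0 u) n5; clear; lra.
have c2u : c (2 * u)%N <= 1011 / 1000 * c u.
  apply: (@doubling_ratio_le R al be c n0 u) => //.
  by apply: right; clear -nu; lia.
have left : 997 / 1000 * c u <= (visits be (0 - u%:Z) u)%:R.
  have h1 := Hb u (leqnn u).
  have h2 := right u; have {}h2 := h2 ltac:(clear -nu; lia).
  have : (centred be 0 u <= visits be (0 - u%:Z) u + visits al 0 u)%N.
    rewrite centred0_split//; apply: leq_add; last exact: visits_le.
    by apply: visits_sub; clear -u0; lia.
  rewrite -(ler_nat R) natrD; clear -h1 h2; lra.
(* z = - j is a median point of be in the cluster. *)
have exj : exists j : nat, 4 / 10 * c u <= (visits be (0 - j%:Z) j)%:R.
  by exists u; clear -left cu; lra.
have [j jge jmin] := ex_minnP exj.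
have ju : (j <= u)%N by apply: jmin; clear -left cu; lra.
have j0 : (0 < j)%N.
  rewrite lt0n; apply/eqP => j0; move: jge; rewrite j0 visits0.
  by clear -cu; lra.
pose z : int := 0 - j%:Z.
have jm1 : (visits be (0 - j.-1%:Z) j.-1)%:R < 4 / 10 * c u.
  by rewrite ltNge; apply/negP => /jmin; clear -j0; lia.
have vj : visits be z j = (be z + visits be (0 - j.-1%:Z) j.-1)%N.
  rewrite (@visits_split be z 1%N j (0 - j.-1%:Z)); last 2 first.
    by clear -j0; lia.
    by rewrite /z; clear -j0; lia.
  by rewrite visitsS visits0 addr0 add0n subn1.
have bz : be z.
  apply/negPn/negP => /negPf nbz; move: jge; rewrite -/z vj nbz add0n.
  by clear -jm1; lra.
have jle : (visits be z j)%:R <= 4 / 10 * c u + 1.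
  by rewrite vj bz natrD -[nat_of_bool _]/1%N; clear -jm1; lra.
have lefthalf : 597 / 1000 * c u - 1 <= (visits be (0 - u%:Z) (u - j))%:R.
  move: left; rewrite (@visits_split be (0 - u%:Z) (u - j) u z); last 2 first.
    exact: leq_subr.
    by rewrite /z; clear -ju; lia.
  by rewrite subKn// natrD; clear -jle; lra.
(* r is the radius at which the window around z reaches 1.2 c_u points. *)
have exr : exists r : nat, 12 / 10 * c u <= (centred al z r)%:R.
  have [r n0r cr] := Hinf (2 * c u).
  by exists r; have := HcL z bz r n0r; clear -cr cu; lra.
have [r rge rmin] := ex_minnP exr.
have n02u : (n0 <= 2 * u)%N by clear -n0u; lia.
have z2u := HcU z bz _ n02u.
have r2u : (2 * u < r)%N.
  rewrite ltnNge; apply/negP => r2u.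
  have := centred_le al z _ _ r2u.
  by rewrite -(ler_nat R); clear -rge z2u c2u cu; lra.
have rle : (centred al z r)%:R <= 12 / 10 * c u + 2.
  have h : (centred al z r.-1)%:R < 12 / 10 * c u.
    by rewrite ltNge; apply/negP => /rmin; clear -r2u; lia.
  have := centredS_le al z r.-1; rewrite prednK; last by clear -r2u; lia.
  rewrite -(ler_nat R) natrD; clear -h; lra.
have n0r : (n0 <= r)%N by clear -n0u r2u; lia.
have crle : c r <= 121 / 100 * c u.
  by have := HcL z bz r n0r; clear -rle cu; lra.
(* Growth bounds c_(2r) by 8 c_r, so only few points of al around z miss be. *)
pose bad k := al k && ~~ be k.
have badle : (centred bad 0 (2 * r))%:R <= 3 / 100 * c u.
  have h1 := HcU 0 b0 (2 * r)%N ltac:(clear -n0r; lia).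
  have h2 := Hb (2 * r)%N ltac:(clear -r2u; lia).
  have h3 : centred al 0 (2 * r) = (centred be 0 (2 * r) + centred bad 0 (2 * r))%N.
    exact: visits_diff.
  have rR : (0 : R) < r%:R by rewrite ltr0n; clear -r2u; lia.
  have h4 : r%:R * c (2 * r)%N <= 4 * (2 * r)%:R * c r.
    apply: (@growth R al be) => //.
    - by move=> k bk; apply: HcU.
    - by clear -r2u; lia.
    - by have := c0 (2 * r)%N; move: h2; clear; lra.
  have h5 : c (2 * r)%N <= 8 * c r.
    by rewrite -(ler_pM2l rR) (le_trans h4)// natrM; clear; lra.
  by move: h1; rewrite h3 natrD; clear -h2 h5 crle cu; lra.
have badin p m : 0 - (2 * r)%N%:Z < p -> p + m%:Z <= (2 * r)%N%:Z ->
    3 / 100 * c u < (visits al p m)%:R ->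
    exists2 k, be k & p <= k < p + m%:Z.
  move=> h1 h2 h3.
  have [[k /andP[bk kr]]|nk] := pselect (exists k, be k && (p <= k < p + m%:Z)).
    by exists k.
  have : (visits al p m <= centred bad 0 (2 * r))%N.
    apply: (@leq_trans (visits bad p m)); last first.
      by apply: visits_sub; clear -h1 h2 r2u; lia.
    apply: visits_le_in => k kr ak; rewrite /bad ak /=.
    by apply/negP => bk; apply: nk; exists k; rewrite bk.
  rewrite -(ler_nat R); clear -badle h3; lra.
have split3 : (centred al z r = visits al (z - r%:Z + 1) (r - 2 * u) +
    (centred al z (2 * u) + visits al (z + (2 * u)%N%:Z) (r - 2 * u)))%N.
  rewrite /centred.
  rewrite (_ : (r + r).-1 =
    (r - 2 * u) + ((2 * u + 2 * u).-1 + (r - 2 * u)))%N; last by clear -r2u u0; lia.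
  rewrite !visits_cat; congr (_ + (visits _ _ _ + visits _ _ _))%N.
    by clear -r2u; lia.
  by clear -r2u u0; lia.
(* The contradiction: x counts the half of the cluster between z and k. *)
have arith (x : R) : 4 / 10 * c u - 1 <= x ->
    999 / 1000 * c u + x <= 1001 / 1000 * c r -> False.
  by clear -crle cu; lra.
move: rge; rewrite split3 !natrD => rge.
have [/badin|hl] := ltP (3 / 100 * c u) (visits al (z - r%:Z + 1) (r - 2 * u))%:R.
  case=> [||k bk kr].
  - by rewrite /z; clear -r2u ju; lia.
  - by rewrite /z; clear -r2u ju u0; lia.
  apply: (@arith (visits be (0 - u%:Z) (u - j))%:R).
    by clear -lefthalf cu; lra.
  apply: le_trans (HcU k bk r n0r).
  apply: (le_trans (lerD (HcL k bk u n0u) (lexx _))).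
  rewrite -natrD ler_nat.
  apply: (leq_trans (leq_add (leqnn _) (visits_le _ _ _ _ ba))).
  apply: visits_sub2; move: kr; rewrite /z; clear -r2u ju u0 j0; lia.
have [/badin|hr] := ltP (3 / 100 * c u) (visits al (z + (2 * u)%N%:Z) (r - 2 * u))%:R.
  case=> [||k bk kr].
  - by rewrite /z; clear -r2u ju; lia.
  - by rewrite /z; clear -r2u ju u0; lia.
  apply: (@arith (visits be z j)%:R).
    by move: jge; rewrite -/z; clear; lra.
  apply: le_trans (HcU k bk r n0r).
  apply: (le_trans (lerD (HcL k bk u n0u) (lexx _))).
  rewrite -natrD ler_nat addnC.
  apply: (leq_trans (leq_add (visits_le _ _ _ _ ba) (leqnn _))).
  apply: visits_sub2; move: kr; rewrite /z; clear -r2u ju u0 j0; lia.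
clear -hl hr rge z2u c2u cu; lra.
Qed.

(** * Orbits of a transformation that is invertible on an invariant set *)

Lemma visits_shift P k p n :
  visits (fun i => P (k + i)) p n = visits P (k + p) n.
Proof. by apply: eq_bigr => i _; rewrite addrA. Qed.

Lemma visits_unbounded (P : int -> bool) :
  (forall N, exists2 i, (N <= i)%N & P i%:Z) ->
  forall K, exists n, (K <= visits P 0 n)%N.
Proof.
move=> io; elim=> [|K [n Kn]]; first by exists 0%N.
have [i ni Pi] := io n; exists i.+1; rewrite visitsS add0r Pi addn1 ltnS.
by apply: (leq_trans Kn); apply: visits_sub; lia.
Qed.

Section orbits.
Context {R : realType} {d : measure_display} {X : measurableType d}.
Context {T Tinv : X -> X} {X0 : set X}.
Context (mX0 : measurable X0) (mTinv : measurable_fun X0 Tinv)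
  (mT : measurable_fun [set: X] T)
  (TX0 : set_fun X0 X0 T) (TinvX0 : set_fun X0 X0 Tinv)
  (TK : {in X0, cancel T Tinv}) (TinvK : {in X0, cancel Tinv T}).

Definition orbit_visits (A : set X) (x : X) (k : int) : bool :=
  iterz T Tinv k x \in A.

Lemma iter_stable n x : X0 x -> X0 (iter n T x).
Proof. by move=> ?; elim: n => // n; rewrite iterS; exact: TX0. Qed.

Lemma iter_inv_stable n x : X0 x -> X0 (iter n Tinv x).
Proof. by move=> ?; elim: n => // n; rewrite iterS; exact: TinvX0. Qed.

Lemma iterz_stable k x : X0 x -> X0 (iterz T Tinv k x).
Proof. by case: k => n; [exact: iter_stable|exact: iter_inv_stable]. Qed.

Lemma iterz_succ k x : X0 x -> iterz T Tinv (1 + k) x = T (iterz T Tinv k x).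
Proof.
move=> X0x; case: k => [n //|n].
have -> : iterz T Tinv (1 + Negz n) x = iter n Tinv x.
  by case: n => [//|n]; have -> : 1 + Negz n.+1 = Negz n by lia.
by rewrite /iterz iterS TinvK// inE; exact: iter_inv_stable.
Qed.

Lemma iterz_pred k x :
  X0 x -> iterz T Tinv (- 1 + k) x = Tinv (iterz T Tinv k x).
Proof.
move=> X0x; have -> : k = 1 + (- 1 + k) by lia.
rewrite iterz_succ// TK ?inE; first by congr iterz; lia.
exact: iterz_stable.
Qed.

Lemma iterz_add j k x : X0 x ->
  iterz T Tinv j (iterz T Tinv k x) = iterz T Tinv (k + j) x.
Proof.
move=> X0x; have X0k := iterz_stable k x X0x.
case: j => n; elim: n => [|n IH].
- by rewrite addr0.
- by rewrite (_ : k + n.+1 = 1 + (k + n)) ?iterz_succ -?IH//; lia.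
- by rewrite (_ : k + Negz 0 = - 1 + k) ?iterz_pred//; lia.
- by rewrite (_ : k + Negz n.+1 = - 1 + (k + Negz n)) ?iterz_pred -?IH//; lia.
Qed.

Lemma orbit_visits_shift A k x i : X0 x ->
  orbit_visits A (iterz T Tinv k x) i = orbit_visits A x (k + i).
Proof. by move=> X0x; rewrite /orbit_visits iterz_add. Qed.

Lemma centred_orbit A k x n : X0 x ->
  centred (orbit_visits A x) k n =
  centred (orbit_visits A (iterz T Tinv k x)) 0 n.
Proof.
move=> X0x; rewrite /centred.
rewrite (_ : k - n%:Z + 1 = k + (0 - n%:Z + 1)); last by lia.
rewrite -visits_shift; apply: eq_bigr => i _.
by rewrite orbit_visits_shift.
Qed.

Lemma visits_orbit A k x n : X0 x ->
  visits (orbit_visits A x) k n =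
  visits (orbit_visits A (iterz T Tinv k x)) 0 n.
Proof.
move=> X0x; rewrite -[k in LHS]addr0 -visits_shift; apply: eq_bigr => i _.
by rewrite orbit_visits_shift.
Qed.

Lemma symmetric_birkhoff_sumE A n x :
  symmetric_birkhoff_sum T Tinv (\1_A : X -> R) n x =
  (centred (orbit_visits A x) 0 n)%:R.
Proof.
rewrite /symmetric_birkhoff_sum.
pose s := [seq 0 - n%:Z + 1 + i%:Z | i <- iota 0 (n + n).-1].
have -> : [set k : int | (`|k| < n)%N] = [set` s].
  apply/seteqP; split=> k /=; last by move=> /mapP[i]; rewrite mem_iota; lia.
  move=> kn; apply/mapP; exists `|(k + n%:Z - 1)%R|%N; last by lia.
  by rewrite mem_iota; lia.
rewrite -fsbig_seq; last by rewrite map_inj_uniq ?iota_uniq// => i j; lia.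
rewrite big_map /centred /visits natr_sum -(big_mkord xpredT (fun i : nat =>
  (orbit_visits A x (0 - n%:Z + 1 + i%:Z))%:R)) /index_iota subn0.
by apply: eq_bigr => i _; rewrite indicE.
Qed.

Lemma measurable_iter A n : measurable A ->
  measurable [set x | A (iter n T x)].
Proof.
elim: n A => // n IH A mA; have mTA : measurable (T @^-1` A).
  by rewrite -[X in measurable X]setTI; exact: mT.
exact: (IH _ mTA).
Qed.

Lemma measurable_iterz A k : measurable A ->
  measurable (X0 `&` [set x | A (iterz T Tinv k x)]).
Proof.
move=> mA; case: k => n.
  by apply: measurableI => //; exact: measurable_iter.
elim: n => [|n IH]; first exact: mTinv.
have E x : iterz T Tinv (Negz n.+1) x = iterz T Tinv (Negz n) (Tinv x).
  exact: iterSr.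
rewrite (_ : _ `&` _ =
  X0 `&` Tinv @^-1` (X0 `&` [set x | A (iterz T Tinv (Negz n) x)])).
  exact: mTinv.
apply/seteqP; split=> x [X0x Ax]; split=> //.
  by split; [exact: TinvX0|rewrite /mkset -E].
by rewrite /mkset E; case: Ax.
Qed.

Lemma measurable_visits A p n : measurable A ->
  measurable_fun X0 (fun x => (visits (orbit_visits A x) p n)%:R : R).
Proof.
move=> mA; under eq_fun do rewrite natr_sum.
apply: measurable_sum => i.
apply: (eq_measurable_fun (\1_(X0 `&` [set x | A (iterz T Tinv (p + i%:Z) x)]) : X -> R)).
  move=> x; rewrite inE => X0x; rewrite indicE /orbit_visits; congr (_%:R).
  by congr nat_of_bool; apply/idP/idP; rewrite !inE // => -[].
by apply: measurable_indic; exact: measurable_iterz.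
Qed.

Context {m : {measure set X -> \bar R}}.

(** * Recurrence *)

Lemma ae_exists (B : set X) (P : X -> Prop) : measurable B -> (0 < m B)%E ->
  {ae m, forall x, P x} -> exists2 x, B x & P x.
Proof.
move=> mB B0 aeP; apply/not_exists2P => noP.
suff : m.-negligible B by move/(measure_negligible mB) => mB0; rewrite mB0 ltxx in B0.
by apply: negligibleS aeP => x Bx /= Px; case: (noP x).
Qed.

Context (mpT : forall A, measurable A -> m (T @^-1` A) = m A)
  (consT : conservative m T) (ergT : ergodic m T).

Lemma measure_preimage_iter n A : measurable A ->
  m [set x | A (iter n T x)] = m A.
Proof.
elim: n A => // n IH A mA; have mTA : measurable (T @^-1` A).
  by rewrite -[X in measurable X]setTI; exact: mT.
by rewrite -(mpT A mA) -(IH _ mTA).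
Qed.

(** The points with finitely many future visits to [G] form an invariant set [U].
    If [U] were co-null, almost every point of [G] would have a last visit to
    [G]; but the points of [G] that never come back form a wandering set. *)
Lemma recurrence G : measurable G -> (0 < m G)%E ->
  {ae m, forall x, forall N, exists2 i, (N <= i)%N & G (iter i T x)}.
Proof.
move=> mG G0.
pose E := \bigcap_(i in [set i | (0 < i)%N]) [set x | ~ G (iter i T x)].
have mE : measurable E.
  apply: bigcap_measurable => [|i _]; first by exists 1%N.
  by apply: measurableC; exact: measurable_iter.
pose U := \bigcup_n [set x | E (iter n T x)].
have mU : measurable U by apply: bigcup_measurable => n _; exact: measurable_iter.
suff U0 : m U = 0%E.
  exists U; split => // x /= nx; apply: contrapT => nU; apply: nx => N.
  apply: contrapT => nN; apply: nU; exists N => // i /= i0 Gi.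
  by apply: nN; exists (i + N)%N; [exact: leq_addl|rewrite iterD].
have UT : T @^-1` U = U.
  apply/seteqP; split=> x [n _ En].
    by exists n.+1 => //=; rewrite -iterS iterSr.
  exists n => // i i0; rewrite /= -iterSr -iterD -[(i + _)%N]addSnnS iterD.
  exact: En.
have [//|CU0] := ergT U mU UT.
pose W := G `&` E.
have mW : measurable W by exact: measurableI.
have W0 : m W = 0%E.
  apply/eqP/negPn/negP => W0; apply: consT; exists W; split.
    split=> // i j _ _; wlog ij : i j / (i < j)%N => [H|].
      have [ij|ji|//] := ltngtP i j; first exact: H.
      by rewrite setIC => /(H _ _ ji).
    move=> [x [[_ Ei] [Gj _]]]; exfalso.
    apply: (Ei (j - i)%N); first by rewrite /= subn_gt0.
    by rewrite /= -iterD subnK// ltnW.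
  by rewrite lt_neqAle eq_sym W0 measure_ge0.
suff : m.-negligible G by move/(measure_negligible mG) => H; rewrite H ltxx in G0.
apply: (@negligibleS _ _ _ _ (~` U `|` \bigcup_n [set x | W (iter n T x)])).
  move=> x Gx; have [[n _ En]|nU] := pselect (U x); last by left.
  right.
  have ex : exists i, (i <= n)%N && (iter i T x \in G) by exists 0%N; rewrite inE.
  have ub i : (i <= n)%N && (iter i T x \in G) -> (i <= n)%N by case/andP.
  have [i /andP[ilen /set_mem Gi] imax] := ex_maxnP ex ub.
  exists i => //; split=> // j /= j0 Gj; rewrite -iterD in Gj.
  have [jn|nj] := leqP (j + i) n.
    have := imax (j + i)%N; rewrite jn mem_set// => /(_ isT).
    by clear -j0; rewrite /= in j0; lia.
  apply: (En (j + i - n)%N); first by rewrite /= subn_gt0.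
  by rewrite /= -iterD subnK// ltnW.
apply: negligibleU.
  by apply/negligibleP => //; exact: measurableC.
apply: negligible_bigcup => n; apply/negligibleP; first exact: measurable_iter.
by rewrite -W0; exact: measure_preimage_iter.
Qed.

End orbits.

(** * Consequences of the symmetric law *)

Lemma finite_measure_above (R : realType) (d : measure_display)
    (X : measurableType d) (m : {sigma_finite_measure set X -> \bar R}) (K : R) :
  m [set: X] = +oo%E ->
  exists A, [/\ measurable A, (K%:E <= m A)%E & (m A < +oo)%E].
Proof.
move=> moo.
have /sigma_finiteP[F [FT Fnd mF]] := sigma_finiteT m.
have : m \o F @ \oo --> m (\bigcup_n F n).
  apply: nondecreasing_cvg_mu => // [i|]; first by case: (mF i).
  by rewrite -FT.
rewrite -FT moo => /cvgeyPge/(_ K)[N _ /(_ N (leqnn N)) /= FN].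
by exists (F N); have [? ?] := mF N.
Qed.

Section symmetric_law.
Context {R : realType} {d : measure_display} {X : measurableType d}.
Context {m : {measure set X -> \bar R}} {T Tinv : X -> X} {X0 : set X}.
Context (mX0 : measurable X0) (mTinv : measurable_fun X0 Tinv)
  (mT : measurable_fun [set: X] T)
  (TX0 : set_fun X0 X0 T) (TinvX0 : set_fun X0 X0 Tinv)
  (TK : {in X0, cancel T Tinv}) (TinvK : {in X0, cancel Tinv T}).
Context {a : nat -> R} (a_gt0 : forall n, (1 <= n)%N -> 0 < a n).
Context (law : forall A : set X, measurable A -> (0 < m A)%E ->
  (m A < +oo)%E -> {ae m, forall x : X,
    symmetric_birkhoff_sum T Tinv (\1_A : X -> R) n x / a n
      @[n --> \oo] --> fine (m A)}).

Let sym_count A x n : R := (centred (orbit_visits (T:=T) (Tinv:=Tinv) A x) 0 n)%:R.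

(** The absolute value makes the normalising sequence nonnegative at 0 as well,
    where the sign of [a] is unconstrained. *)
Lemma near_law (A : set X) (e : R) : measurable A -> (0 < m A)%E ->
  (m A < +oo)%E -> 0 < e ->
  {ae m, forall x, exists N, forall n, (N <= n)%N ->
    (fine (m A) - e) * `|a n| <= sym_count A x n <= (fine (m A) + e) * `|a n|}.
Proof.
move=> mA A0 Aoo e0; apply: filterS (law A mA A0 Aoo) => x /cvgrPdist_le/(_ e e0).
case=> N _ NP; exists (maxn N 1) => n nN.
have n1 : (1 <= n)%N by lia.
have {NP} := NP n; rewrite /= symmetric_birkhoff_sumE -/(sym_count A x n) => NP.
have an := a_gt0 n n1.
have {NP} := NP ltac:(lia).
by rewrite ler_distlC ler_pdivlMr// ler_pdivrMr// gtr0_norm.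
Qed.

(** Egorov's theorem for the normalised symmetric sums. *)
Lemma uniform_law (A : set X) (e e' : R) : measurable A -> A `<=` X0 ->
  (0 < m A)%E -> (m A < +oo)%E -> 0 < e -> 0 < e' ->
  exists B N, [/\ measurable B, B `<=` A, fine (m A) - e' <= fine (m B) &
    forall x, B x -> forall n, (N <= n)%N ->
      (fine (m A) - e) * `|a n| <= sym_count A x n <= (fine (m A) + e) * `|a n|].
Proof.
move=> mA AX0 A0 Aoo e0 e'0.
have [||//|//||//|B [mB Be' unif]] := @ae_pointwise_almost_uniform d R X m
  (fun n x => sym_count A x n / a n) (cst (fine (m A))) A e'.
- move=> n; apply: (measurable_funS mX0) => //.
  apply: measurable_funM; last exact: measurable_cst.
  exact: measurable_visits.
- exact: measurable_cst.
- apply: filterS (law A mA A0 Aoo) => x + _.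
  by under eq_fun do rewrite symmetric_birkhoff_sumE.
pose S := [set h : X -> R | forall y, (A `\` B) y -> `|fine (m A) - h y| < e].
have : nbhs (cst (fine (m A)) : {uniform` (A `\` B) -> R}) S.
  apply/uniform_nbhs; exists [set xy | `|xy.1 - xy.2| < e]; split => //.
  by rewrite -entourage_ballE; exists e.
move=> /unif[N _ NP].
have finA : m A \is a fin_num by rewrite ge0_fin_numE.
exists (A `\` B), (maxn N 1); split.
- exact: measurableD.
- by move=> x [].
- have h : (m A <= m (A `\` B) + m B)%E.
    apply: (@le_trans _ _ (m ((A `\` B) `|` B))).
      apply: le_measure; rewrite ?inE//.
        by apply: measurableU => //; exact: measurableD.
      by move=> x Ax; have [|] := pselect (B x); [right|left].
    by apply: measureU2; [exact: measurableD|].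
  have finAB : m (A `\` B) \is a fin_num.
    rewrite ge0_fin_numE//; apply: le_lt_trans Aoo; apply: le_measure.
    - by rewrite inE; exact: measurableD.
    - by rewrite inE.
    - exact: subDsetl.
  rewrite lerBlDr -lee_fin EFinD !fineK//.
  by apply: (le_trans h); rewrite leeD2l// ltW.
move=> x Bx n nN.
have n1 : (1 <= n)%N by lia.
have an := a_gt0 n n1.
have := NP n ltac:(rewrite /=; lia) x Bx; rewrite ltr_distlC ltr_pdivlMr// ltr_pdivrMr//.
by rewrite gtr0_norm// => /andP[/ltW -> /ltW ->].
Qed.

(** * Small and large forward counts *)

Context (mpT : forall A, measurable A -> m (T @^-1` A) = m A)
  (consT : conservative m T) (ergT : ergodic m T).

(* From here on, B is a set of almost full measure in A on which the law for A
   holds uniformly. *)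
Context {A B : set X} {N0 : nat}.
Let M := fine (m A).
Let c n := `|a n| * M.
Let orb := orbit_visits (T:=T) (Tinv:=Tinv).
Context (mA : measurable A) (AX0 : A `<=` X0) (A0 : (0 < m A)%E)
  (Aoo : (m A < +oo)%E) (mB : measurable B) (BA : B `<=` A)
  (Bbig : 999 / 1000 * M <= fine (m B))
  (Bunif : forall x, B x -> forall n, (N0 <= n)%N ->
     999 / 1000 * c n <= sym_count A x n <= 1001 / 1000 * c n).

Let M0 : 0 < M. Proof. by rewrite fine_gt0// A0. Qed.
Let c0 n : 0 <= c n. Proof. by rewrite mulr_ge0// ltW. Qed.
Let c_gt0 n : (0 < n)%N -> 0 < c n.
Proof. by move=> n0; rewrite mulr_gt0// normr_gt0 gt_eqF// a_gt0. Qed.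
Let B0 : (0 < m B)%E.
Proof.
rewrite -(@fineK _ (m B)) ?lte_fin; first by apply: lt_le_trans Bbig; move: M0; lra.
rewrite ge0_fin_numE//; apply: le_lt_trans Aoo.
by apply: le_measure; rewrite ?inE.
Qed.
Let Boo : (m B < +oo)%E.
Proof. by apply: le_lt_trans Aoo; apply: le_measure; rewrite ?inE. Qed.

Let orbBA x k : orb B x k -> orb A x k.
Proof. by rewrite /orb /orbit_visits !inE; exact: BA. Qed.

Let orbBunif x k : X0 x -> orb B x k -> forall n, (N0 <= n)%N ->
  999 / 1000 * c n <= (centred (orb A x) k n)%:R <= 1001 / 1000 * c n.
Proof.
move=> X0x bk n nN; rewrite /orb (centred_orbit (X0:=X0))//.
by apply: Bunif => //; move: bk; rewrite /orb /orbit_visits inE.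
Qed.

Let lawB : {ae m, forall x, exists N, forall n, (N <= n)%N ->
  998 / 1000 * c n <= sym_count B x n}.
Proof.
have e0 : 0 < M / 1000 by move: M0; lra.
apply: filterS (near_law B (M / 1000) mB B0 Boo e0) => x [N NP].
exists N => n /NP /andP[h _]; apply: le_trans h.
have := normr_ge0 (a n); rewrite /c => an.
have : (998 / 1000 * M) * `|a n| <= (fine (m B) - M / 1000) * `|a n|.
  by apply: ler_wpM2r => //; move: Bbig M0; lra.
by lra.
Qed.

(** The constant comes from growth: with [u = n %/ 4] one has [c n <= 20 * c u], so
    the forward half of the orbit holds less than [c u / 1000] visits up to
    time [n].  Recurrence makes [c] tend to infinity, so that single visits are
    negligible. *)
Lemma forward_count_not_small :
  ~ {ae m, forall x, B x -> forall k, exists2 n, (k <= n)%N &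
      (visits (orb A x) 0 n)%:R < c n / 20 / 1000}.
Proof.
move=> aeH.
have [x Bx [Hx [[N1 NB] rec]]] := ae_exists _ _ mB B0
  (filterI aeH (filterI lawB (recurrence mT mpT consT ergT A mA A0))).
have X0x : X0 x by apply/AX0/BA.
have orb0 : orb B x 0 by rewrite /orb /orbit_visits inE.
have unb : forall K : nat, exists n, (K <= visits (orb A x) 0 n)%N.
  apply: visits_unbounded => N; have [i iN Ai] := rec N; exists i => //.
  by rewrite /orb /orbit_visits inE.
have cinf (K : R) : exists N, forall n, (N <= n)%N -> K <= c n.
  have [n Kn] := unb (Num.bound `|2 * K|).
  exists (maxn n N0) => r rn.
  have /andP[_] := orbBunif x 0 X0x orb0 r (leq_trans (leq_maxr _ _) rn).
  have : (visits (orb A x) 0 n <= centred (orb A x) 0 r)%N.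
    case: n {Kn} rn => [|n] rn; first by rewrite visits0.
    by apply: visits_sub; move: rn; clear; lia.
  rewrite -(ler_nat R) => h1 h2.
  have h3 : 2 * K <= (visits (orb A x) 0 n)%:R.
    apply: (le_trans (ler_norm _)); apply: (le_trans (ltW (archi_boundP _))) => //.
    by rewrite ler_nat.
  by have := c0 r; move: h1 h2 h3; lra.
have [N2 cN2] := cinf 1000.
pose P := (N0 + N1 + N2 + 3)%N.
have [n nk vn] := Hx Bx (4 * P)%N.
apply: (@one_sided_orbit_absurd R (orb A x) (orb B x) c N0 (n %/ 4) n) vn => //.
- exact: orbBA.
- by move=> k bk r rN; exact: orbBunif.
- by move=> r rn; apply: NB; move: nk rn; rewrite /P; clear; lia.
- move=> K; have [N cN] := cinf K; exists (maxn N N0); first exact: leq_maxr.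
  by apply: cN; exact: leq_maxl.
- by move: nk; rewrite /P; clear; lia.
- by move: nk; rewrite /P; clear; lia.
- by move: nk; rewrite /P; clear; lia.
- by apply: cN2; move: nk; rewrite /P; clear; lia.
Qed.

Context (m_infinite : forall K : R,
  exists A', [/\ measurable A', (K%:E <= m A')%E & (m A' < +oo)%E]).

(** The law is applied to the points D of A that meet G within L steps, instead of
    to the small set of those that do not: the latter might be null, and then
    the law would say nothing about it. *)
Lemma forward_count_not_bounded_below (G : set X) (e : R) (k0 : nat) :
  measurable G -> G `<=` B -> (0 < m G)%E -> 0 < e <= 1 ->
  (forall x, G x -> forall n, (k0 <= n)%N ->
     e * c n <= (visits (orb A x) 0 n)%:R) ->
  False.
Proof.
move=> mG GB G0 /andP[e0 e1] HG.
pose E L' := A `&`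
  ~` \bigcup_(i in [set i | (0 < i <= L')%N]) [set x | G (iter i T x)].
have mE L' : measurable (E L').
  apply: measurableI => //; apply: measurableC; apply: bigcup_measurable => i _.
  exact: measurable_iter.
have finA : m A \is a fin_num by rewrite ge0_fin_numE.
have Me0 : 0 < M * e / 1000 by have := mulr_gt0 M0 e0; lra.
have [L EL] : exists L, (m (E L) < (M * e / 1000)%:E)%E.
  have cv : m \o E @ \oo --> m (\bigcap_n E n).
    apply: nonincreasing_cvg_mu => //.
    - apply: le_lt_trans Aoo; apply: le_measure; rewrite ?inE//.
      by move=> x [].
    - exact: bigcap_measurable.
    - move=> i j ij; apply/subsetPset => x [Ax nG]; split=> // -[k /= kr Gk].
      by apply: nG; exists k => //=; move: kr ij; clear; lia.
  have E0 : m (\bigcap_n E n) = 0%E.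
    apply: measure_negligible; first exact: bigcap_measurable.
    apply: negligibleS (recurrence mT mpT consT ergT G mG G0).
    move=> x Ex /= /(_ 1%N)[i i1 Gi].
    by have [_] := Ex i I; apply; exists i => //=; rewrite i1 leqnn.
  rewrite E0 in cv.
  have /fine_cvgP[finE /cvgr_lt/(_ _ Me0) ltE] := cv.
  have [L [finL ltL]] := @filter_ex _ _ _ _ (filterI finE ltE).
  by exists L; rewrite -[m _](fineK finL) lte_fin.
have EA : E L `<=` A by move=> x [].
pose D := A `\` E L.
have mD : measurable D by exact: measurableD.
have finE : m (E L) \is a fin_num.
  by rewrite ge0_fin_numE// (lt_trans EL)// ltry.
have mDE : m D = (m A - m (E L))%E.
  by rewrite /D measureD// setIidr.
have mDM : fine (m D) = M - fine (m (E L)) by rewrite mDE fineB.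
have ELM : fine (m (E L)) < M * e / 1000 by rewrite -lte_fin fineK.
have Doo : (m D < +oo)%E.
  by apply: le_lt_trans Aoo; apply: le_measure; rewrite ?inE// => x [].
have D0 : (0 < m D)%E.
  rewrite -(@fineK _ (m D)) ?ge0_fin_numE// lte_fin mDM.
  have := ler_wpM2l (ltW M0) e1; move: ELM M0; lra.
pose n0 := maxn N0 k0.
pose Q : R := (n0 + L + 1)%:R.
have Q0 : 0 <= Q by [].
(* The law for A' forces c_n <= n / (4 Q) for large n. *)
have [A' [mA' A'K A'oo]] := m_infinite (8 * Q * M + 1).
have K1 : 0 < 8 * Q * M + 1 by have := mulr_ge0 Q0 (ltW M0); lra.
have A'0 : (0 < m A')%E by apply: lt_le_trans A'K.
have fA'K : 8 * Q * M + 1 <= fine (m A').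
  by rewrite -lee_fin fineK// ge0_fin_numE.
have [x Gx [[[NA hA] [ND hD]] [[NB hB] [N' hA']]]] :=
  ae_exists _ _ mG G0 (filterI
    (filterI (near_law A (M * e / 1000) mA A0 Aoo Me0)
             (near_law D (M * e / 1000) mD D0 Doo Me0))
    (filterI lawB (near_law A' 1 mA' A'0 A'oo ltr01))).
have X0x : X0 x by apply/AX0/BA/GB.
pose n := (n0 + NA + ND + NB + N' + 1)%N.
have n_gt0 : (0 < n)%N by rewrite /n addn1.
have /andP[_ {}hA] := hA n ltac:(rewrite /n; clear; lia).
have /andP[{}hD _] := hD n ltac:(rewrite /n; clear; lia).
have {}hB := hB n ltac:(rewrite /n; clear; lia).
have /andP[{}hA' _] := hA' n ltac:(rewrite /n; clear; lia).
have an : 0 < `|a n| by rewrite normr_gt0 gt_eqF// a_gt0.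
apply: (@balanced_orbit_absurd R (orb A x) (orb B x) (orb G x) (orb D x) c e n0 L n).
- exact: orbBA.
- by move=> k; rewrite /orb /orbit_visits !inE; exact: GB.
- by move=> k; rewrite /orb /orbit_visits !inE => -[].
- exact: c0.
- exact: c_gt0.
- exact: e0.
- move=> k bk r rn.
  by have /andP[] := orbBunif x k X0x bk r (leq_trans (leq_maxl _ _) rn).
- move=> k gk r rn; rewrite /orb (visits_orbit (X0 := X0))//.
  apply: HG; last exact: leq_trans (leq_maxr _ _) rn.
  by move: gk; rewrite /orb /orbit_visits inE.
- move=> k; rewrite /orb /orbit_visits inE => -[Ak nE].
  have [i ir Gi] : exists2 i, (0 < i <= L)%N & G (iter i T (iterz T Tinv k x)).
    by apply: contrapT => nG; apply: nE; split=> // -[i /= ir Gi]; apply: nG; exists i.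
  by exists i => //; rewrite inE -(iterz_add (X0 := X0)).
- by rewrite /orb /orbit_visits inE.
- by rewrite /n; clear; lia.
- by move: hB (c0 n); rewrite /sym_count -/orb; lra.
- move: hA hD; rewrite /sym_count -/orb mDM -/M => hA hD.
  have h : (2 * (M * e / 1000) + fine (m (E L))) * `|a n| < 3 * (M * e / 1000) * `|a n|.
    by rewrite ltr_pM2r//; move: ELM; lra.
  have h' : 0 < M * e * `|a n| by rewrite !mulr_gt0.
  by move: hA hD h h'; rewrite /c; lra.
- have h1 : 8 * Q * M * `|a n| <= (fine (m A') - 1) * `|a n|.
    by rewrite ler_pM2r//; move: fA'K; lra.
  have h2 : sym_count A' x n <= 2 * n%:R.
    rewrite -natrM ler_nat; apply: leq_trans (visits_size _ _ _) _.
    by clear; lia.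
  by move: h1 h2 hA'; rewrite /c -/Q; lra.
Qed.

End symmetric_law.

(** * Absence of a symmetric law in infinite measure *)

Theorem theorem2 (R : realType) (d : measure_display) (X : measurableType d)
    (m : {sigma_finite_measure set X -> \bar R}) (T Tinv : X -> X)
    (X_standard : standard_borel R X)
    (T_invertible : invertible_mod_null m T Tinv)
    (T_preserving : measure_preserving m T)
    (T_conservative : conservative m T)
    (T_ergodic : ergodic m T)
    (m_infinite : m [set: X] = +oo%E) :
  ~ exists a : nat -> R,
      (forall n : nat, (1 <= n)%N -> 0 < a n) /\
      (forall A : set X, measurable A -> (0 < m A)%E -> (m A < +oo)%E ->
         {ae m, forall x : X,
           symmetric_birkhoff_sum T Tinv (\1_A : X -> R) n x / a n
             @[n --> \oo] --> fine (m A)}).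
Proof.
move=> [a [a_gt0 law]].
have [mT mpT] := T_preserving.
have [X0 [mX0 X0null [_ mTinv] [TX0 TinvX0] [TK TinvK]]] := T_invertible.
have large K := finite_measure_above R d X m K m_infinite.
have [A1 [mA1 A11 A1oo]] := large 1.
pose A := A1 `&` X0.
have mA : measurable A by exact: measurableI.
have AX0 : A `<=` X0 by move=> x [].
have A0 : (0 < m A)%E.
  apply: (@lt_le_trans _ _ (m A1)); first by apply: lt_le_trans A11.
  rewrite -[leRHS]adde0 -X0null.
  apply: (@le_trans _ _ (m (A `|` ~` X0))).
    apply: le_measure; rewrite ?inE//.
      by apply: measurableU => //; exact: measurableC.
    by move=> x A1x; have [X0x|nX0x] := pselect (X0 x); [left|right].
  by apply: measureU2 => //; exact: measurableC.
have Aoo : (m A < +oo)%E.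
  by apply: le_lt_trans A1oo; apply: le_measure; rewrite ?inE// => x [].
set M := fine (m A).
have M0 : 0 < M by rewrite fine_gt0// A0.
have e0 : 0 < M / 1000 by lra.
have [B [N [mB BA Bbig BN]]] := uniform_law mX0 mTinv mT TinvX0
  a_gt0 law A _ _ mA AX0 A0 Aoo e0 e0.
pose c n := `|a n| * M.
have Bunif x : B x -> forall n, (N <= n)%N -> 999 / 1000 * c n <=
    (centred (orbit_visits (T:=T) (Tinv:=Tinv) A x) 0 n)%:R <= 1001 / 1000 * c n.
  move=> Bx n /(BN x Bx n); rewrite -/M /c => /andP[h1 h2].
  by apply/andP; split; [move: h1|move: h2]; lra.
have {}Bbig : 999 / 1000 * M <= fine (m B) by move: Bbig; rewrite -/M; lra.
(* G k consists of the points of B whose forward counts are not small from time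
   k on; either some G k has positive measure or almost every point of B has
   small forward counts infinitely often. *)
pose e : R := (20 * 1000)^-1.
have e_gt0 : 0 < e by rewrite invr_gt0; lra.
have e_le1 : e <= 1 by rewrite invf_le1; lra.
pose G k := \bigcap_(n in [set n | (k <= n)%N]) (B `&`
  (X0 `&` (fun x => (visits (orbit_visits (T:=T) (Tinv:=Tinv) A x) 0 n)%:R : R)
     @^-1` `[e * c n, +oo[)).
have mG k : measurable (G k).
  apply: bigcap_measurable => [|n _]; first by exists k => /=.
  apply: measurableI => //.
  apply: (measurable_visits mX0 mTinv mT TinvX0 A 0 n mA mX0).
  exact: measurable_itv.
have GE k x : G k x -> forall n, (k <= n)%N ->
    e * c n <= (visits (orbit_visits (T:=T) (Tinv:=Tinv) A x) 0 n)%:R.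
  by move=> Gx n kn; have [_ [_ /=]] := Gx n kn; rewrite in_itv/= andbT.
have [[k Gk]|noG] := pselect (exists k, (0 < m (G k))%E).
  apply: (forward_count_not_bounded_below mT TX0 TinvX0 TK TinvK
    a_gt0 law mpT T_conservative T_ergodic mA AX0 A0 Aoo mB BA Bbig Bunif
    large (G k) e k (mG k) _ Gk _ (GE k)).
    by move=> x Gx; have [] := Gx k (leqnn k).
  by rewrite e_gt0 e_le1.
apply: (forward_count_not_small mT TX0 TinvX0 TK TinvK
  a_gt0 law mpT T_conservative T_ergodic mA AX0 A0 Aoo mB BA Bbig Bunif).
have Gnull : m.-negligible (\bigcup_k G k).
  apply: negligible_bigcup => k; apply/negligibleP => //; apply/eqP.
  by apply/negPn/negP => Gk; apply: noG; exists k; rewrite lt0e Gk measure_ge0.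
apply: negligibleS Gnull => x /= nx; apply: contrapT => nG; apply: nx => Bx k.
apply: contrapT => nk; apply: nG; exists k => // n /= kn.
split=> //; split; first exact/AX0/BA.
rewrite /= in_itv/= andbT leNgt; apply/negP => small; apply: nk; exists n => //.
apply: (lt_le_trans small); rewrite le_eqVlt; apply/orP; left; apply/eqP.
by rewrite -mulrA -invfM mulrC.
Qed.
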